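(* Let $\alpha,\beta,\gamma\in\mathbb{R}$ with $\alpha\neq 0$, let $s(x)=\alpha x^2+\beta x+\gamma$ for $x\in\mathbb{R}$, and let $S:=\{(x,s(x)) : x\in\mathbb{R}\}\subset\mathbb{R}^2$ be its graph. Let $(\overline{x},\overline{y})\in\mathbb{R}^2\setminus S$, and set $$p := -\frac{\beta^{2} + 4 \alpha \overline{y} - 4 \alpha \gamma - 2}{4 \alpha^{2}},\qquad q := -\frac{2 \alpha \overline{x} + \beta}{4 \alpha^{3}},\qquad \Delta := (p/3)^3+(q/2)^2.$$ Then the projection of $(\overline{x},\overline{y})$ onto $S$ is $$P_S(\overline{x},\overline{y})=\begin{cases} (x_1,s(x_1)) & \text{if }p=0\text{ or }\Delta>0,\\ (x_2,s(x_2)) & \text{if }p<0\text{ and }\Delta=0,\\ \{(x^+_3,s(x^+_3)),(x^-_3,s(x^-_3))\} &\text{if }\Delta<0\text{ and }\overline{x}=-\frac{\beta}{2\alpha},\\ (x_4,s(x_4)) &\text{if }\Delta<0\text{ and }q<0,\\ (x_5,s(x_5)) &\text{if }\Delta<0\text{ and }q>0, \end{cases}$$ where, in the respective cases, $$x_1:=-\frac{\beta}{2\alpha}+\sqrt[3]{\frac{2\alpha\overline{x}+\beta}{8\alpha^3}-\sqrt{\Delta}}+\sqrt[3]{\frac{2\alpha\overline{x}+\beta}{8\alpha^3}+ \sqrt{\Delta}},$$ $$x_2:=-\frac{\beta}{2 \alpha} + \frac{3 (2 \alpha \overline{x} + \beta)}{(\beta^{2} + 4 \alpha \overline{y} - 4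 \alpha \gamma - 2) \alpha},$$ $$x_3^\pm:=-\frac{\beta}{2\alpha}\pm\sqrt{-p},$$ $$x_4:=-\frac{\beta}{2\alpha}+2\sqrt{\frac{-p}{3}}\cos\Big(\frac{\theta}{3}\Big),\qquad x_5:=-\frac{\beta}{2\alpha}+2\sqrt{\frac{-p}{3}}\cos\Big(\frac{\theta+2\pi}{3}\Big),$$ and $\theta := \arccos \dfrac{-q/2}{(-p/3)^{3/2}}$.
   Context: $\|\cdot\|$ is the Euclidean norm. For a set $S\subset\mathbb{R}^2$ and a point $z\in\mathbb{R}^2$, the projection $P_S(z)$ is the set of all points of $S$ at minimal Euclidean distance from $z$, i.e. all $u\in S$ with $\|u-z\|=\min_{v\in S}\|v-z\|$. When this set is a singleton it is identified with its unique element, so ''$P_S(z)=u$'' means that $u$ is the unique nearest point. Here $\sqrt[3]{\cdot}$ denotes the real cube root (defined on all of $\mathbb{R}$), and $\arccos$ takes values in $[0,\pi]$. Each of the quantities $x_1,x_2,x_3^\pm,x_4,x_5$ is only considered in the case in which it is used. *)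

(* Defs.v *)
From mathcomp Require Import all_boot all_order all_algebra.
From mathcomp Require Import all_classical all_reals all_analysis.

Set Implicit Arguments.
Unset Strict Implicit.
Unset Printing Implicit Defensive.

Import Order.TTheory GRing.Theory Num.Theory.

Local Open Scope classical_set_scope.
Local Open Scope ring_scope.

(* The norm `|_| that the library puts on R * R is the maximum norm. *)
Definition eucl_norm (R : realType) (z : R * R) : R :=
  Num.sqrt (z.1 ^+ 2 + z.2 ^+ 2).

Definition projection (R : realType) (S : set (R * R)) (z : R * R) :
    set (R * R) :=
  [set u | S u /\ forall v, S v -> eucl_norm (u - z) <= eucl_norm (v - z)].

(* powR (the operation `^) is the usual power only for a nonnegative base, so
   the sign is treated apart. *)
Definition cbrt (R : realType) (x : R) : R := Num.sg x * (`|x| `^ (3^-1)).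

Lemma cbrtK (R : realType) (x : R) : cbrt x ^+ 3 = x.
Proof.
rewrite /cbrt exprMn -(@powR_mulrn _ (_ `^ _)) ?powR_ge0// -powRrM mulVf ?pnatr_eq0//.
rewrite powRr1 ?normr_ge0// exprS sqr_sg.
have [->|x0] := eqVneq x 0; first by rewrite normr0 mulr0.
by rewrite mulr1 -numEsg.
Qed.

(* Main.v *)
Require Import Defs.
From mathcomp Require Import all_boot all_order all_algebra.
From mathcomp Require Import all_classical all_reals all_analysis.
From mathcomp Require Import ring lra.

Import Order.TTheory GRing.Theory Num.Theory.

Local Open Scope classical_set_scope.
Local Open Scope ring_scope.

(** In the coordinate [t = x + beta / (2 alpha)], the squared distance to the
    point [(x, s x)] is [alpha ^ 2 (t ^ 4 + 2 p t ^ 2 + 4 q t)] plus a constant,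
    whose critical points are the roots of [t ^ 3 + p t + q].  Subtracting its
    value at a root [t0] leaves
    [alpha ^ 2 (t - t0) ^ 2 ((t + t0) ^ 2 + 2 (t0 ^ 2 + p))], so a root with
    [0 <= t0 ^ 2 + p] is a global minimizer, and the only other possible one is
    [- t0], when [t0 ^ 2 + p = 0].  The candidates of the theorem (Cardano's
    formula, the simple root [3 q / p] when [Delta = 0], Viete's trigonometric
    formula) are roots of this kind. *)

(** * Auxiliary facts on cubes, cosines and powers *)

Lemma expr3_inj (R : realFieldType) : injective (fun x : R => x ^+ 3).
Proof.
move=> x y /= exy; apply/eqP; rewrite -subr_eq0; apply/negPn/negP => xy.
have : (x - y) * (x ^+ 2 + x * y + y ^+ 2) = 0.
  by apply: etrans (_ : x ^+ 3 - y ^+ 3 = 0); [ring|rewrite exy subrr].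
move/eqP; rewrite mulf_eq0 (negPf xy)/= => /eqP e.
(* The cofactor [x ^+ 2 + x * y + y ^+ 2] is positive definite, so it vanishes only at the
   origin. *)
have y0 : y = 0 by apply/eqP; rewrite -sqrf_eq0; apply/eqP; nra.
have x0 : x = 0 by apply/eqP; rewrite -sqrf_eq0; apply/eqP; nra.
by rewrite x0 y0 subrr eqxx in xy.
Qed.

Lemma cos_mulr3n (R : realType) (x : R) :
  cos (x *+ 3) = 4 * cos x ^+ 3 - 3 * cos x.
Proof.
rewrite mulrSr cosD cos_mulr2n sin_mulr2n.
have -> : (cos x * sin x) *+ 2 * sin x = cos x * sin x ^+ 2 *+ 2 by ring.
by rewrite sin2cos2; ring.
Qed.

Lemma powR3half (R : realType) (x : R) : 0 <= x -> x `^ (3 / 2) = Num.sqrt x ^+ 3.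
Proof.
move=> x0.
by rewrite mulrC powRrM powR12_sqrt// powR_mulrn// sqrtr_ge0.
Qed.

(** * Nearest points obtained from a root of the cubic *)

Section projection_parabola.
Variables (R : realType) (alpha beta gamma xbar ybar p q : R).

Let s (x : R) : R := alpha * x ^+ 2 + beta * x + gamma.
Let P := projection [set (x, s x) | x in [set: R]] (xbar, ybar).

Hypothesis alpha_neq0 : alpha != 0.
Hypothesis pE :
  p = - ((beta ^+ 2 + 4 * alpha * ybar - 4 * alpha * gamma - 2)
         / (4 * alpha ^+ 2)).
Hypothesis qE : q = - ((2 * alpha * xbar + beta) / (4 * alpha ^+ 3)).

Lemma dist_parabolaB (x t : R) : t ^+ 3 + p * t + q = 0 ->
  let x0 := - (beta / (2 * alpha)) + t in
  (x - xbar) ^+ 2 + (s x - ybar) ^+ 2 - ((x0 - xbar) ^+ 2 + (s x0 - ybar) ^+ 2) =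
  alpha ^+ 2 * ((x - x0) ^+ 2 * ((x - x0 + 2 * t) ^+ 2 + 2 * (t ^+ 2 + p))).
Proof.
move=> t0 x0.
(* Solving the definitions of [q] and [p] for [xbar] and [ybar], and the cubic for [q], turns the
   claim into a rational identity. *)
have xbarE : xbar = - (beta / (2 * alpha)) - 2 * alpha ^+ 2 * q.
  by rewrite qE; field.
have ybarE : ybar = gamma - beta ^+ 2 / (4 * alpha) + (2 * alpha)^-1 - alpha * p.
  by rewrite pE; field.
have q0 : q = - (t ^+ 3 + p * t) by apply/eqP; rewrite -subr_eq0 opprK addrC t0.
by rewrite /s /x0 xbarE ybarE q0; field.
Qed.

Lemma projection_parabola (t : R) : t ^+ 3 + p * t + q = 0 -> 0 <= t ^+ 2 + p ->
  let x0 := - (beta / (2 * alpha)) + t in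
  P = [set (x, s x) | x in
        [set x | x = x0 \/ (t ^+ 2 + p = 0 /\ x = - (beta / (2 * alpha)) - t)]].
Proof.
move=> rt pt x0.
have dB x := dist_parabolaB x t rt.
have a0 : 0 < alpha ^+ 2 by rewrite exprn_even_gt0.
have normE x y : (eucl_norm ((x, s x) - (xbar, ybar))
    <= eucl_norm ((y, s y) - (xbar, ybar))) =
    ((x - xbar) ^+ 2 + (s x - ybar) ^+ 2 <= (y - xbar) ^+ 2 + (s y - ybar) ^+ 2).
  by rewrite /eucl_norm/= ler_sqrt// addr_ge0 ?sqr_ge0.
(* For [x != x0] the last factor is a sum of two nonnegative terms; if it is nonpositive, both
   vanish. *)
have facE x : alpha ^+ 2 * ((x - x0) ^+ 2 * ((x - x0 + 2 * t) ^+ 2 + 2 * (t ^+ 2 + p)))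
    <= 0 -> x = x0 \/ (t ^+ 2 + p = 0 /\ x = - (beta / (2 * alpha)) - t).
  rewrite pmulr_rle0//.
  have [-> _|xx0] := eqVneq x x0; first by left.
  rewrite pmulr_rle0 ?exprn_even_gt0 ?subr_eq0// => h; right.
  have tp : t ^+ 2 + p = 0.
    by have := sqr_ge0 (x - x0 + 2 * t); move: h pt; lra.
  split=> //; move: h; rewrite tp mulr0 addr0 => h.
  have : (x - x0 + 2 * t) ^+ 2 == 0 by rewrite eq_le h sqr_ge0.
  by rewrite sqrf_eq0 => /eqP; rewrite /x0; lra.
have minx0 x : (x0 - xbar) ^+ 2 + (s x0 - ybar) ^+ 2 <=
    (x - xbar) ^+ 2 + (s x - ybar) ^+ 2.
  rewrite -subr_ge0 dB mulr_ge0 ?sqr_ge0// mulr_ge0 ?sqr_ge0//.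
  by rewrite addr_ge0 ?sqr_ge0// mulr_ge0.
apply/seteqP; split => [_ [[x _ <-] minx]|_ [x xE <-]].
  exists x => //; apply: facE; rewrite -dB subr_le0 -normE.
  by apply: minx; exists x0.
split; first by exists x.
move=> _ [y _ <-]; rewrite normE; apply: le_trans (minx0 y).
rewrite -subr_le0 dB -/x0; case: xE => [->|[-> ->]].
  by rewrite subrr expr0n/= mul0r mulr0.
have -> : - (beta / (2 * alpha)) - t - x0 + 2 * t = 0 by rewrite /x0; ring.
by rewrite expr0n/= mulr0 addr0 !mulr0.
Qed.

(** The extra hypothesis makes the mirror candidate [- t], when it occurs, coincide with [t]. *)
Lemma projection_parabola1 (t : R) : t ^+ 3 + p * t + q = 0 -> 0 <= t ^+ 2 + p ->
    (t ^+ 2 + p = 0 -> t = 0) ->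
  let x0 := - (beta / (2 * alpha)) + t in P = [set (x0, s x0)].
Proof.
move=> rt pt t0 x0; rewrite (projection_parabola t rt pt) -/x0.
rewrite -(image_set1 (fun x => (x, s x))); congr image.
apply/seteqP; split=> x /= => [[//|[/t0 e ->]]|]; last by left.
by rewrite /x0 e subr0 addr0.
Qed.

End projection_parabola.

(** * Roots for nonnegative discriminant *)

Lemma cardano_root (R : realType) (p q : R) :
  let Delta := (p / 3) ^+ 3 + (q / 2) ^+ 2 in
  let t := cbrt (- (q / 2) - Num.sqrt Delta)
           + cbrt (- (q / 2) + Num.sqrt Delta) in
  0 <= Delta -> (Delta = 0 -> p = 0) ->
  [/\ t ^+ 3 + p * t + q = 0, 0 <= t ^+ 2 + p & t ^+ 2 + p = 0 -> t = 0].
Proof.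
move=> Delta t D0 Dp; rewrite /t.
have := cbrtK (- (q / 2) - Num.sqrt Delta).
have := cbrtK (- (q / 2) + Num.sqrt Delta).
set v := cbrt (_ + _); set u := cbrt (_ - _) => v3 u3.
have D2 : Num.sqrt Delta ^+ 2 = Delta by rewrite sqr_sqrtr.
(* Cubes suffice: [u ^+ 3 * v ^+ 3] is [(q / 2) ^+ 2 - Delta], that is, [- (p / 3) ^+ 3]. *)
have uv : u * v = - (p / 3).
  apply: (@expr3_inj R) => /=; rewrite exprMn u3 v3.
  have -> : (- (q / 2) - Num.sqrt Delta) * (- (q / 2) + Num.sqrt Delta) =
    (q / 2) ^+ 2 - Num.sqrt Delta ^+ 2 by ring.
  by rewrite D2 /Delta; ring.
have pE : p = - 3 * (u * v) by rewrite uv; field.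
(* This is [u ^+ 2 - u * v + v ^+ 2] with the square completed; it vanishes only for [u = v = 0]. *)
have tpE : (u + v) ^+ 2 + p = (u - v / 2) ^+ 2 + 3 / 4 * v ^+ 2.
  by rewrite pE; field.
split.
- have -> : (u + v) ^+ 3 + p * (u + v) + q = u ^+ 3 + v ^+ 3 + q.
    by rewrite pE; ring.
  by rewrite u3 v3; field.
- by rewrite tpE addr_ge0 ?sqr_ge0// mulr_ge0 ?sqr_ge0.
- rewrite tpE => /eqP.
  rewrite paddr_eq0 ?sqr_ge0//; last by rewrite mulr_ge0 ?sqr_ge0.
  rewrite sqrf_eq0 mulf_eq0 sqrf_eq0 => /andP[/eqP uv0 /orP[/eqP|/eqP v0]].
    by lra.
  by move: uv0; rewrite v0 mul0r subr0 => ->; rewrite addr0.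
Qed.

(** The double root is [- 3 * q / (2 * p)], and [t] is the remaining simple one. A vanishing
    discriminant gives [t ^+ 2 = - 4 / 3 * p], so that [t ^+ 2 + p = - p / 3]. *)
Lemma double_root (R : realFieldType) (p q : R) (t := 3 * q / p) :
  p < 0 -> (p / 3) ^+ 3 + (q / 2) ^+ 2 = 0 ->
  t ^+ 3 + p * t + q = 0 /\ 0 < t ^+ 2 + p.
Proof.
move=> p0 D0; have pn0 : p != 0 by rewrite lt_eqF.
have q2 : q ^+ 2 = - 4 / 27 * p ^+ 3.
  have -> : q ^+ 2 = 4 * ((p / 3) ^+ 3 + (q / 2) ^+ 2) - 4 / 27 * p ^+ 3 by field.
  by rewrite D0; ring.
have t2 : t ^+ 2 = - 4 / 3 * p.
  have -> : t ^+ 2 = 9 * q ^+ 2 / p ^+ 2 by rewrite /t; field.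
  by rewrite q2; field.
split; last by rewrite t2; lra.
have -> : t ^+ 3 = t ^+ 2 * t by ring.
by rewrite t2 /t; field.
Qed.

(* Since [t * (t ^ 2 + p) = - q], the sign condition says [0 < t ^ 2 + p]. *)
Lemma root_global (R : realFieldType) (p q t : R) :
  t ^+ 3 + p * t + q = 0 -> q * t < 0 -> 0 < t ^+ 2 + p.
Proof.
move=> rt qt.
have t0 : t != 0 by apply: contraTneq qt => ->; rewrite mulr0 ltxx.
have : 0 < t ^+ 2 * (t ^+ 2 + p).
  have -> : t ^+ 2 * (t ^+ 2 + p) = t * (t ^+ 3 + p * t + q) - q * t by ring.
  by rewrite rt mulr0 sub0r oppr_gt0.
by rewrite pmulr_rgt0 // exprn_even_gt0.
Qed.

(** * Trigonometric roots for negative discriminant *)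

Section viete.
Variables (R : realType) (p q : R).
Hypothesis D0 : (p / 3) ^+ 3 + (q / 2) ^+ 2 < 0.

(** With this [r], the substitution [t = 2 * r * cos phi] turns the cubic into
    [2 * r ^+ 3 * cos (phi *+ 3) + q]. *)
Let r := Num.sqrt (- p / 3).
Let theta := acos ((- q / 2) / ((- p / 3) `^ (3 / 2))).

Lemma viete_p_lt0 : p < 0.
Proof.
rewrite ltNge; apply/negP => p0; move: D0; rewrite ltNge.
by rewrite addr_ge0 ?sqr_ge0// exprn_ge0// divr_ge0.
Qed.

Lemma viete_radius_gt0 : 0 < r.
Proof. by have := viete_p_lt0; rewrite sqrtr_gt0; lra. Qed.

Lemma viete_radius_sqr : r ^+ 2 = - p / 3.
Proof. by have := viete_p_lt0 => p0; rewrite sqr_sqrtr//; lra. Qed.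

(** A negative discriminant means [(q / 2) ^+ 2 < r ^+ 6], so the argument of [acos] lies in
    [[-1, 1]], where [cos] undoes [acos]. *)
Lemma viete_angle : [/\ 0 <= theta, theta <= pi & 2 * r ^+ 3 * cos theta = - q].
Proof.
have p0 := viete_p_lt0; have r0 := viete_radius_gt0; have r2 := viete_radius_sqr.
have r3 : 0 < r ^+ 3 by rewrite exprn_gt0.
have : `|(- q / 2) / r ^+ 3| <= 1.
  rewrite normrM normfV (gtr0_norm r3) ler_pdivrMr// mul1r.
  rewrite -[leRHS]gtr0_norm// -ler_sqr ?nnegrE// !real_normK ?num_real//.
  have -> : (r ^+ 3) ^+ 2 = (r ^+ 2) ^+ 3 by ring.
  rewrite r2; move: D0; lra.
rewrite ler_norml => /acos_def.
rewrite /theta powR3half -/r; last lra.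
move=> [/andP[? ?] ->]; split=> //.
by field; rewrite gt_eqF.
Qed.

Lemma viete_root (phi : R) : cos (phi *+ 3) = cos theta -> q * cos phi < 0 ->
  let t := 2 * r * cos phi in t ^+ 3 + p * t + q = 0 /\ 0 < t ^+ 2 + p.
Proof.
move=> phi3 qphi t; have r0 := viete_radius_gt0; have r2 := viete_radius_sqr.
have [_ _ qE] := viete_angle.
have pE : p = - 3 * r ^+ 2 by rewrite r2; field.
have rt : t ^+ 3 + p * t + q = 0.
  have -> : q = - (2 * r ^+ 3 * cos theta) by rewrite qE opprK.
  by rewrite -phi3 cos_mulr3n pE /t; ring.
split=> //; apply: root_global rt _.
have -> : q * t = 2 * r * (q * cos phi) by rewrite /t; ring.
by rewrite pmulr_rlt0// mulr_gt0.
Qed.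

(** The angle lies in [[0, pi / 3]], where the cosine is positive. *)
Lemma viete_root_lt0 : q < 0 -> let t := 2 * r * cos (theta / 3) in
  t ^+ 3 + p * t + q = 0 /\ 0 < t ^+ 2 + p.
Proof.
move=> q0; have [th0 thpi _] := viete_angle; have pi0 := pi_gt0 R.
apply: viete_root; first by congr cos; field.
by rewrite nmulr_rlt0// cos_gt0_pihalf//; apply/andP; split; lra.
Qed.

(** The angle lies in [[2 * pi / 3, pi]], where the cosine is negative; a shift by [pi] brings it to
    [[- pi / 3, 0]]. *)
Lemma viete_root_gt0 : 0 < q -> let t := 2 * r * cos ((theta + 2 * pi) / 3) in
  t ^+ 3 + p * t + q = 0 /\ 0 < t ^+ 2 + p.
Proof.
move=> q0; have [th0 thpi _] := viete_angle; have pi0 := pi_gt0 R.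
apply: viete_root.
  by rewrite -[RHS]cosD2pi; congr cos; field.
rewrite pmulr_rlt0// -[X in cos X](subrK pi) cosDpi oppr_lt0 cos_gt0_pihalf//.
by apply/andP; split; lra.
Qed.

End viete.

(** * Assembly of the five cases *)

Theorem theorem3p1 (R : realType) (alpha beta gamma : R) (xbar ybar : R) :
  let s : R -> R := fun x => alpha * x ^+ 2 + beta * x + gamma in
  let S : set (R * R) := [set (x, s x) | x in [set: R]] in
  let p : R := - ((beta ^+ 2 + 4 * alpha * ybar - 4 * alpha * gamma - 2)
                  / (4 * alpha ^+ 2)) in
  let q : R := - ((2 * alpha * xbar + beta) / (4 * alpha ^+ 3)) in
  let Delta : R := (p / 3) ^+ 3 + (q / 2) ^+ 2 in
  let x1 : R := - (beta / (2 * alpha))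
    + cbrt ((2 * alpha * xbar + beta) / (8 * alpha ^+ 3) - Num.sqrt Delta)
    + cbrt ((2 * alpha * xbar + beta) / (8 * alpha ^+ 3) + Num.sqrt Delta) in
  let x2 : R := - (beta / (2 * alpha))
    + 3 * (2 * alpha * xbar + beta)
      / ((beta ^+ 2 + 4 * alpha * ybar - 4 * alpha * gamma - 2) * alpha) in
  let x3p : R := - (beta / (2 * alpha)) + Num.sqrt (- p) in
  let x3m : R := - (beta / (2 * alpha)) - Num.sqrt (- p) in
  let theta : R := acos ((- q / 2) / ((- p / 3) `^ (3 / 2))) in
  let x4 : R := - (beta / (2 * alpha))
    + 2 * Num.sqrt (- p / 3) * cos (theta / 3) in
  let x5 : R := - (beta / (2 * alpha))
    + 2 * Num.sqrt (- p / 3) * cos ((theta + 2 * pi) / 3) in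
  let P : set (R * R) := projection S (xbar, ybar) in
  let case1 : Prop := p = 0 \/ 0 < Delta in
  let case2 : Prop := p < 0 /\ Delta = 0 in
  let case3 : Prop := Delta < 0 /\ xbar = - (beta / (2 * alpha)) in
  let case4 : Prop := Delta < 0 /\ q < 0 in
  let case5 : Prop := Delta < 0 /\ 0 < q in
  alpha != 0 ->
  ~ S (xbar, ybar) ->
  (case1 -> P = [set (x1, s x1)]) /\
  (case2 -> P = [set (x2, s x2)]) /\
  (case3 -> P = [set (x3p, s x3p); (x3m, s x3m)]) /\
  (case4 -> P = [set (x4, s x4)]) /\
  (case5 -> P = [set (x5, s x5)]) /\
  (case1 \/ case2 \/ case3 \/ case4 \/ case5).
Proof.
move=> s S p q Delta x1 x2 x3p x3m theta x4 x5 P case1 case2 case3 case4 case5.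
move=> alpha0 _.
have proj := projection_parabola R alpha beta gamma xbar ybar p q alpha0
  (erefl _) (erefl _).
have proj1 := projection_parabola1 R alpha beta gamma xbar ybar p q alpha0
  (erefl _) (erefl _).
have proj1' t (rt : t ^+ 3 + p * t + q = 0 /\ 0 < t ^+ 2 + p) : 
    let x0 := - (beta / (2 * alpha)) + t in P = [set (x0, s x0)].
  case: rt => rt tp; apply: proj1 => //; first exact: ltW.
  by move=> e; rewrite e ltxx in tp.
(* The point lies on the axis of the parabola exactly when [q = 0]. *)
have q0E : xbar = - (beta / (2 * alpha)) <-> q = 0.
  split=> [xE|q0]; first by rewrite /q xE; field.
  have -> : xbar = - (beta / (2 * alpha)) - 2 * alpha ^+ 2 * q.
    by rewrite /q; field.
  by rewrite q0 mulr0 subr0.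
do 5?[split].
- move=> c1; rewrite /x1 -addrA.
  have -> : (2 * alpha * xbar + beta) / (8 * alpha ^+ 3) = - (q / 2).
    by rewrite /q; field.
  have [D0 Dp] : 0 <= Delta /\ (Delta = 0 -> p = 0).
    case: c1 => [p0|D0]; last by split; [exact: ltW|move=> D; rewrite D ltxx in D0].
    by split => //; rewrite /Delta p0 mul0r expr0n/= add0r sqr_ge0.
  by have [rt tp t0] := cardano_root _ p q D0 Dp; exact: proj1.
- move=> [p0 D0].
  have -> : x2 = - (beta / (2 * alpha)) + 3 * q / p.
    rewrite /x2; congr (_ + _).
    (* The numerator of [p] is a factor of the denominator in [x2], so [p != 0] justifies the
       division. *)
    have : p != 0 by rewrite lt_eqF.
    rewrite /p oppr_eq0 mulf_eq0 negb_or => /andP[h _].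
    by rewrite /q /p; field; rewrite h alpha0.
  exact: proj1' (double_root _ _ _ p0 D0).
- move=> [D0 /q0E q0].
  have p0 := viete_p_lt0 _ _ _ D0.
  have sp : Num.sqrt (- p) ^+ 2 = - p by rewrite sqr_sqrtr// oppr_ge0 ltW.
  (* This is the borderline case, in which [t] and [- t] are both minimizers. *)
  have tp : Num.sqrt (- p) ^+ 2 + p = 0 by rewrite sp addNr.
  have rt : Num.sqrt (- p) ^+ 3 + p * Num.sqrt (- p) + q = 0.
    by rewrite q0 exprSr sp addr0 mulNr addNr.
  apply: (etrans (proj _ rt _)); first by rewrite tp.
  rewrite -[in RHS](image_set1 (fun x => (x, s x))).
  rewrite -[in RHS](image_set1 (fun x => (x, s x)) x3m) -image_setU.
  congr image; apply/seteqP; split=> x /=.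
    by case=> [->|[_ ->]]; [left|right].
  by case=> ->; [left|right].
- by move=> [D0 q0]; exact: proj1' (viete_root_lt0 _ _ _ D0 q0).
- by move=> [D0 q0]; exact: proj1' (viete_root_gt0 _ _ _ D0 q0).
(* Exhaustiveness: [Delta < 0] splits by the sign of [q], and [Delta = 0] by that of [p], where
   [0 < p] would make [Delta] positive. *)
have [D0|D0|D0] := ltgtP Delta 0.
- have [q0|q0|q0] := ltgtP q 0.
  + by right; right; right; left.
  + by right; right; right; right.
  + by right; right; left; split => //; apply/q0E.
- by left; right.
have [p0|p0|p0] := ltgtP p 0.
- by right; left.
- have : 0 < Delta by rewrite ltr_wpDr ?sqr_ge0// exprn_gt0// divr_gt0.
  by rewrite D0 ltxx.
- by left; left.
Qed.
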